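(* Let $\Omega$ be a finite set and let $\Gamma\subseteq\Omega\times\Omega$ be a vertex-primitive digraph on $\Omega$ with $\Gamma\neq\emptyset$ and $\Gamma\neq\Omega\times\Omega$. Let $n=|\Omega|$ be the order of $\Gamma$ and let $d$ be its valency (every vertex has the same valency $d$). For each integer $i$, let $\Gamma_i$ be the graph on $\Omega$ consisting of all pairs $(\alpha,\beta)\in\Omega\times\Omega$ with $|\Gamma(\alpha)\cap\Gamma(\beta)|=d-i$. Let $\kappa$ be the smallest positive integer $i$ such that $\Gamma_i\neq\emptyset$. Then either (1) $\Gamma_0\cup\Gamma_\kappa=\Omega\times\Omega$ and $(n-1)(d-\kappa)=d(d-1)$; or (2) there exists $i\in\{\kappa,\ldots,d-1\}$ such that $\Gamma_i$ has valency at least $1$ and at most $\kappa^2+\kappa$.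
   Context: A digraph on a finite set $\Omega$ is a subset $\Gamma\subseteq\Omega\times\Omega$; for $v\in\Omega$, its neighbourhood is $\Gamma(v)=\{u\in\Omega:(v,u)\in\Gamma\}$ and its valency is $|\Gamma(v)|$. $\Gamma$ is regular of valency $d$ if every vertex has valency $d$. The automorphism group $\mathrm{Aut}(\Gamma)$ is the group of permutations of $\Omega$ preserving $\Gamma$; $\Gamma$ is vertex-primitive if $\mathrm{Aut}(\Gamma)$ acts primitively on $\Omega$ (preserves no nontrivial partition of $\Omega$). Each $\Gamma_i$ is invariant under $\mathrm{Aut}(\Gamma)$, and its valency means the common value of $|\Gamma_i(v)|$, $v\in\Omega$. *)

(* Defs.v *)
From HB Require Import structures.
From mathcomp Require Export all_boot all_order all_algebra all_fingroup all_solvable.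

Set Implicit Arguments.
Unset Strict Implicit.
Unset Printing Implicit Defensive.

Import Order.TTheory GRing.Theory Num.Theory.

Definition nbhd (T : finType) (Gamma : {set T * T}) (v : T) : {set T} :=
  [set u | (v, u) \in Gamma].

Definition regular (T : finType) (Gamma : {set T * T}) (d : nat) : Prop :=
  forall v : T, #|nbhd Gamma v| = d.

Definition digraph_aut (T : finType) (Gamma : {set T * T}) : {set {perm T}} :=
  [set s : {perm T} |
    [forall u, forall v, ((s u, s v) \in Gamma) == ((u, v) \in Gamma)]].

Lemma digraph_autP (T : finType) (Gamma : {set T * T}) (s : {perm T}) :
  reflect (forall u v, ((s u, s v) \in Gamma) = ((u, v) \in Gamma))
          (s \in digraph_aut Gamma).
Proof.
rewrite inE; apply: (iffP forallP) => [H u v|H u].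
  by have /forallP/(_ v)/eqP := H u.
by apply/forallP => v; rewrite H.
Qed.

Lemma digraph_aut_group_set (T : finType) (Gamma : {set T * T}) :
  group_set (digraph_aut Gamma).
Proof.
apply/group_setP; split=> [|s t /digraph_autP Hs /digraph_autP Ht].
  by apply/digraph_autP => u v; rewrite !perm1.
by apply/digraph_autP => u v; rewrite !permM Ht Hs.
Qed.

Canonical digraph_aut_group (T : finType) (Gamma : {set T * T}) : {group {perm T}} :=
  Group (digraph_aut_group_set Gamma).

(* The library's [primitive] requires transitivity in addition to the absence
   of an invariant partition Q with 1 < #|Q| < #|T|. *)
Definition vertex_primitive (T : finType) (Gamma : {set T * T}) : bool :=
  [primitive digraph_aut Gamma, on [set: T] | 'P].

(* Gamma_i, where d is the valency of Gamma. The equation is over int, so that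
   d - i is not truncated when d < i. *)
Definition meet_graph (T : finType) (Gamma : {set T * T}) (d : nat) (i : int) :
    {set T * T} :=
  [set p | (#|nbhd Gamma p.1 :&: nbhd Gamma p.2|%:Z == d%:Z - i)%R].

Definition least_positive (P : int -> Prop) (k : int) : Prop :=
  [/\ (0 < k)%R, P k & forall i : int, (0 < i)%R -> P i -> (k <= i)%R].

(* Main.v *)
(** Write [m] for the valency of the graph [E := Gamma_kappa] and count its arcs
    leaving a set. Averaging over the vertices [z], some in-neighbourhood of
    [Gamma], a set of size [d], has at most [m * kappa] arcs leaving it, since
    each arc [(u, v)] of [E] leaves exactly [kappa] of them. If [d <= kappa] or
    [n - d <= kappa], then any two distinct neighbourhoods meet in [d - kappa]
    points and (1) follows by double counting. Otherwise (2) holds with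
    [i = kappa]: if [m > kappa^2 + kappa], take a smallest set [B] of least cut
    among the sets with more than [kappa] points inside and outside. The trivial
    bound [#|B| * (m - #|B| + 1)] on its cut gives [#|B| > 2 * kappa], and
    submodularity of the cut then shows that [B] equals or misses each of its
    translates, so it is a nontrivial block, contradicting primitivity. *)
Require Import Defs.
From mathcomp Require Import zify.
Import Order.TTheory GRing.Theory Num.Theory.

Set Implicit Arguments.
Unset Strict Implicit.
Unset Printing Implicit Defensive.

(** * Blocks of a primitive permutation group *)

(** The translates of [S] have equal size and, by transitivity, partition [T]; this partition is
    [G]-invariant, so primitivity makes it trivial. *)
Lemma primitive_block (T : finType) (G : {group {perm T}}) (S : {set T}) :
    [primitive G, on [set: T] | 'P] -> S != set0 ->
    (forall g : {perm T}, g \in G -> ~~ [disjoint S & g @: S] -> g @: S = S) ->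
  #|S| = 1 \/ S = [set: T].
Proof.
case/andP=> trG /existsPn primG nS0 blockS.
have [S1 | Sn1] := eqVneq #|S| 1; first by left.
right; apply/eqP; rewrite eqEcard subsetT leqNgt cardsT; apply/negP => ltST.
have S_gt0 : 0 < #|S| by rewrite card_gt0.
pose Q := orbit ('P^*)%act G S.
have QP X : reflect (exists2 g : {perm T}, g \in G & X = g @: S) (X \in Q).
  by apply: (iffP imsetP) => -[g Gg ->]; exists g.
have Q_card X : X \in Q -> #|X| = #|S|.
  by case/QP=> g _ ->; rewrite card_imset //; apply: perm_inj.
have partQ : partition Q [set: T].
  apply/and3P; split.
  - apply/eqP/setP=> y; rewrite inE; apply/bigcupP.
    case/set0Pn: nS0 => x Sx.
    have [g Gg ->] := atransP2 trG (in_setT x) (in_setT y).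
    by exists (g @: S); [apply/QP; exists g | apply: imset_f].
  - apply/trivIsetP=> _ _ /QP[g Gg ->] /QP[h Gh ->]; apply: contraR.
    case/pred0Pn=> _ /= /andP[/imsetP[x Sx ->] /imsetP[y Sy gxhy]].
    have -> : h @: S = g @: ((h * g^-1)%g @: S).
      by rewrite -imset_comp; apply: eq_imset => z; rewrite /= permM permKV.
    rewrite (blockS _ (groupM Gh (groupVr Gg))) //.
    apply/pred0Pn; exists x; rewrite /= Sx; apply/imsetP; exists y => //.
    by rewrite permM -gxhy permK.
  - apply/negP=> /Q_card; rewrite cards0 => /esym/eqP.
    by rewrite cards_eq0 (negPf nS0).
have cardT : #|T| = #|Q| * #|S|.
  by rewrite -cardsT; apply: card_uniform_partition partQ => X /Q_card.
case/negP: (primG Q); apply/and3P; split=> //.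
  by apply/actsP=> g Gg X; apply/orbit_transl/mem_orbit.
have S_gt1 : 1 < #|S| by rewrite ltn_neqAle eq_sym Sn1.
move: ltST; rewrite cardsT cardT -[X in X < _]mul1n ltn_pmul2r // => Q_gt1.
by rewrite Q_gt1 -[X in X < _]muln1 ltn_pmul2l // ltnW.
Qed.

(** * Cuts in a graph *)

(** A sum of indicators, so that inequalities between cuts can be checked arc by arc. *)
Definition out_cut (T : finType) (E : {set T * T}) (S : {set T}) : nat :=
  \sum_(p in E) ((p.1 \in S) && (p.2 \notin S)).

Section OutCut.

Variables (T : finType) (E : {set T * T}).
Implicit Types A B S : {set T}.

Lemma out_cut_submod A B :
  out_cut E (A :&: B) + out_cut E (A :|: B) <= out_cut E A + out_cut E B.
Proof.
rewrite /out_cut -!big_split /=; apply: leq_sum => -[x y] _ /=.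
rewrite !inE.
by case: (x \in A); case: (x \in B); case: (y \in A); case: (y \in B).
Qed.

Hypothesis symE : forall x y, ((x, y) \in E) = ((y, x) \in E).

Lemma out_cutC S : out_cut E (~: S) = out_cut E S.
Proof.
pose swap (p : T * T) := (p.2, p.1).
have swapK : involutive swap by case.
rewrite /out_cut (reindex_inj (inv_inj swapK)) /=.
by apply: eq_big => [[x y] | [x y] _]; rewrite ?inE /= 1?symE // negbK andbC.
Qed.

(** This is submodularity for [A] and [~: B]: as [E] is symmetric, complementing a set keeps its
    cut. *)
Lemma out_cut_posimod A B :
  out_cut E (A :\: B) + out_cut E (B :\: A) <= out_cut E A + out_cut E B.
Proof.
have := out_cut_submod A (~: B).
by rewrite out_cutC -setDE -(out_cutC (A :|: _)) setCU setCK setIC -setDE.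
Qed.

Lemma out_cut_aut (g : {perm T}) S :
    (forall x y, ((g x, g y) \in E) = ((x, y) \in E)) ->
  out_cut E (g @: S) = out_cut E S.
Proof.
move=> gE; pose h (p : T * T) := (g p.1, g p.2).
have hI : injective h by move=> [x y] [x' y'] [/perm_inj-> /perm_inj->].
rewrite /out_cut (reindex_inj hI) /=.
apply: eq_big => [[x y] | [x y] _] /=; rewrite ?gE //.
by rewrite !(mem_imset _ _ perm_inj).
Qed.

Lemma out_cutE S : out_cut E S = \sum_(x in S) #|nbhd E x :\: S|.
Proof.
rewrite /out_cut big_mkcond /= [RHS]big_mkcond /=.
under [RHS]eq_bigr => x _ do rewrite -sum1_card big_mkcond /=.
rewrite (eq_bigr (fun p : T * T => if p.1 \in S then
    if p.2 \in nbhd E p.1 :\: S then 1 else 0 else 0)); last first.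
  by case=> x y _; rewrite !inE /=; do !case: (_ \in _).
rewrite -(pair_bigA _ (fun x y => if x \in S then
    if y \in nbhd E x :\: S then 1 else 0 else 0)) /=.
by apply: eq_bigr => x _; case: ifP => // _; rewrite big1.
Qed.

(** Without loops, a vertex of [S] has at most [#|S|.-1] of its [m] neighbours inside [S]. *)
Lemma out_cut_lb m S :
    (forall x, (x, x) \notin E) -> regular E m ->
  #|S| * m <= out_cut E S + #|S| * #|S|.-1.
Proof.
move=> irrE regE; rewrite out_cutE -!sum_nat_const -big_split /=.
apply: leq_sum => x Sx; rewrite -(regE x) -(cardsID S) addnC leq_add2l.
rewrite [#|S|](cardsD1 x) Sx subset_leq_card //.
apply/subsetP=> y; rewrite !inE andbC => /andP[-> Exy]; rewrite andbT.
by apply: contraTneq Exy => ->.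
Qed.

End OutCut.

(** * Least cuts under a primitive group *)

Lemma cut_size_gt (k m s c : nat) :
    0 < k -> k ^ 2 + k < m -> k < s -> c <= m * k -> s * m <= c + s * s.-1 ->
  2 * k < s.
Proof.
move=> k_gt0; rewrite -mulnn => m_gt ks cmk smc.
have [msk | skm] := ltnP m (s + k).
  (* Here [s > m - k > k ^ 2], so [s >= k ^ 2 + 2], which exceeds [2 * k]. *)
  by case: k k_gt0 m_gt ks cmk msk => // k; lia.
(* This range is impossible: in terms of [t] and [u], the bounds on [c] give
   [s + u * (t + 1) <= k ^ 2], while [m > k ^ 2 + k] gives [s + u > k ^ 2]. *)
have [t Et] : exists t, s = k.+1 + t by exists (s - k.+1); lia.
have [u Eu] : exists u, m = s + k + u by exists (m - (s + k)); lia.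
have {}smc : s * m <= m * k + s * s.-1 by lia.
rewrite Eu Et addSn /= in smc m_gt *; lia.
Qed.

(* A smallest set of least cut among those with more than [k] points inside and
   outside is so large that uncrossing forces it to be a block. *)
Lemma primitive_out_cut_gt (T : finType) (G : {group {perm T}})
    (E : {set T * T}) (k m : nat) (S : {set T}) :
    [primitive G, on [set: T] | 'P] ->
    (forall g x y, g \in G -> ((g x, g y) \in E) = ((x, y) \in E)) ->
    (forall x y, ((x, y) \in E) = ((y, x) \in E)) ->
    (forall x, (x, x) \notin E) -> regular E m ->
    0 < k -> k ^ 2 + k < m -> k < #|S| -> k < #|~: S| ->
  m * k < out_cut E S.
Proof.
move=> primG GE symE irrE regE k_gt0 m_gt S_gt SC_gt; rewrite ltnNge.
apply/negP=> cutS.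
pose adm (A : {set T}) := (k < #|A|) && (k < #|~: A|).
have admS : adm S by rewrite /adm S_gt.
have [A admA minA] := arg_minnP (out_cut E) admS.
pose opt (B : {set T}) := adm B && (out_cut E B <= out_cut E A).
have optA : opt A by rewrite /opt admA /=.
have [B /andP[admB cutBA] minB] := arg_minnP (fun B : {set T} => #|B|) optA.
have cutB C : adm C -> out_cut E B <= out_cut E C.
  by move/minA; apply: leq_trans.
have{minB} sizeB C : adm C -> out_cut E C <= out_cut E B -> #|B| <= #|C|.
  by move=> admC CB; apply: minB; rewrite /opt admC (leq_trans CB).
have cutBk : out_cut E B <= m * k := leq_trans (cutB _ admS) cutS.
have [kB kBC] := andP admB.
have cardC (C : {set T}) : #|C| + #|~: C| = #|T| by rewrite cardsC.
(* The complement of [B] competes with [B]: it is admissible with the same cut. *)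
have B_half : #|B| <= #|~: B|.
  by apply: sizeB; rewrite ?out_cutC // /adm setCK kB kBC.
have B_big : 2 * k < #|B|.
  exact: cut_size_gt k_gt0 m_gt kB cutBk (out_cut_lb B irrE regE).
case: (@primitive_block _ G B primG) => [||B1|BT].
- by rewrite -card_gt0; apply: leq_ltn_trans kB.
- move=> g Gg meetB; set C := g @: B.
  have cardCB : #|C| = #|B| by rewrite card_imset //; apply: perm_inj.
  have cutCB : out_cut E C = out_cut E B.
    by apply: out_cut_aut => x y; apply: GE.
  apply/eqP; rewrite eqEcard cardCB leqnn andbT; apply/setIidPl/eqP.
  rewrite eqEcard subsetIl cardCB /=.
  have cBC : #|B :&: C| + #|B :\: C| = #|B| by rewrite cardsID.
  have cCB : #|B :&: C| + #|C :\: B| = #|B| by rewrite -cardCB setIC cardsID.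
  have cU : #|B :|: C| + #|B :&: C| = #|B| + #|B| by rewrite cardsUI cardCB.
  have IgtO : 0 < #|B :&: C|.
    by rewrite card_gt0; rewrite -setI_eq0 in meetB.
  have sm := out_cut_submod E B C; have pm := out_cut_posimod symE B C.
  rewrite cutCB in sm pm.
  have := cardC B; have := cardC (B :&: C); have := cardC (B :|: C).
  have := cardC (B :\: C); have := cardC (C :\: B).
  (* If the intersection is large, so is the complement of the union, since [#|B :|: C| + #|B :&: C|
     = 2 * #|B| <= #|T|]. Submodularity gives [B :&: C] the least cut, hence size at least
     [#|B|]. *)
  have [kI | Ik] := ltnP k #|B :&: C|.
    move=> c1 c2 c3 c4 c5; rewrite setIC.
    have admI : adm (B :&: C) by rewrite /adm; lia.
    have admU : adm (B :|: C) by rewrite /adm; lia.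
    have := sizeB _ admI; have := cutB _ admI; have := cutB _ admU; lia.
  (* Otherwise both differences exceed [2 * k - k] points and have least cut, yet they are smaller
     than [B]. *)
  move=> c1 c2 c3 c4 c5.
  have admBC : adm (B :\: C) by rewrite /adm; lia.
  have admCB : adm (C :\: B) by rewrite /adm; lia.
  have := sizeB _ admBC; have := cutB _ admBC; have := cutB _ admCB; lia.
- by move: kB k_gt0; lia.
- by move: kBC; rewrite BT setCT cards0.
Qed.

(** * Regularity and double counting *)

Lemma card_sum_mem (T : finType) (A : {set T}) : #|A| = \sum_x (x \in A).
Proof. by rewrite -sum1_card big_mkcond; apply: eq_bigr => x _; case: ifP. Qed.

Lemma nbhd_aut (T : finType) (E : {set T * T}) (g : {perm T}) v :
    (forall x y, ((g x, g y) \in E) = ((x, y) \in E)) ->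
  nbhd E (g v) = g @: nbhd E v.
Proof.
move=> gE; apply/setP=> y; rewrite -[y](permKV g) (mem_imset _ _ perm_inj).
by rewrite !inE gE.
Qed.

Lemma transitive_regular (T : finType) (G : {group {perm T}})
    (E : {set T * T}) :
    [transitive G, on [set: T] | 'P] ->
    (forall g x y, g \in G -> ((g x, g y) \in E) = ((x, y) \in E)) ->
  exists v, regular E v.
Proof.
move=> trG GE; have [x _ _] := imsetP trG; exists #|nbhd E x| => y.
have [g Gg ->] := atransP2 trG (in_setT x) (in_setT y).
rewrite [LHS](_ : _ = #|nbhd E (g x)|) // (@nbhd_aut _ _ g) => [|u v].
  by rewrite card_imset //; apply: perm_inj.
exact: GE.
Qed.

(** Its neighbourhoods are the in-neighbourhoods of [E]. *)
Definition converse (T : finType) (E : {set T * T}) : {set T * T} :=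
  [set p | (p.2, p.1) \in E].

Section DoubleCounting.

Variables (T : finType) (Gamma : {set T * T}).

Lemma mem_nbhd_converse x y :
  (x \in nbhd (converse Gamma) y) = (y \in nbhd Gamma x).
Proof. by rewrite !inE. Qed.

Lemma sum_card_nbhd_converse :
  \sum_x #|nbhd (converse Gamma) x| = \sum_x #|nbhd Gamma x|.
Proof.
under eq_bigr => x _ do rewrite card_sum_mem.
under [RHS]eq_bigr => x _ do rewrite card_sum_mem.
rewrite exchange_big; apply: eq_bigr => x _; apply: eq_bigr => y _.
by rewrite mem_nbhd_converse.
Qed.

(** Both sides count the triples [(x, y, z)] with arcs from [x] and from [y] to [z]. *)
Lemma sum_card_nbhdI :
  \sum_x \sum_y #|nbhd Gamma x :&: nbhd Gamma y| =
  \sum_z #|nbhd (converse Gamma) z| ^ 2.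
Proof.
transitivity (\sum_x \sum_y \sum_z
    (z \in nbhd Gamma x) * (z \in nbhd Gamma y)).
  apply: eq_bigr => x _; apply: eq_bigr => y _; rewrite card_sum_mem.
  by apply: eq_bigr => z _; rewrite inE mulnb.
under eq_bigr => x _ do rewrite exchange_big.
rewrite exchange_big; apply: eq_bigr => z _.
rewrite -mulnn card_sum_mem big_distrlr /=.
by apply: eq_bigr => x _; apply: eq_bigr => y _; rewrite !mem_nbhd_converse.
Qed.

(** An arc [(u, v)] of [E] leaves the in-neighbourhood of [z] exactly when [z] lies in
    [nbhd Gamma u] but not in [nbhd Gamma v]. *)
Lemma sum_out_cut_nbhd_converse (E : {set T * T}) :
  \sum_z out_cut E (nbhd (converse Gamma) z) =
  \sum_(p in E) #|nbhd Gamma p.1 :\: nbhd Gamma p.2|.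
Proof.
rewrite /out_cut exchange_big; apply: eq_bigr => p _; rewrite card_sum_mem.
by apply: eq_bigr => z _; rewrite !mem_nbhd_converse in_setD andbC.
Qed.

Lemma card_regular (d : nat) : regular Gamma d -> #|Gamma| = #|T| * d.
Proof.
move=> regG; rewrite -sum_nat_const card_sum_mem.
rewrite (eq_bigr (fun p : T * T => (p.2 \in nbhd Gamma p.1 : nat))); last first.
  by case=> x y _; rewrite inE.
rewrite -(pair_bigA _ (fun x y => (y \in nbhd Gamma x : nat))).
by apply: eq_big => [//|x _]; rewrite -card_sum_mem regG.
Qed.

End DoubleCounting.

(** * Vertex-primitive digraphs: common neighbourhoods and the dichotomy *)

(** The vertices sharing the neighbourhood of [u] form a block. Were it everything, the common
    neighbourhood would be invariant, hence empty or full by transitivity. *)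
Lemma nbhd_inj (T : finType) (Gamma : {set T * T}) :
    vertex_primitive Gamma -> Gamma <> set0 -> Gamma <> [set: T * T] ->
  injective (nbhd Gamma).
Proof.
move=> primG nG0 nGT u v euv; have [trG _] := andP primG.
have aut_nbhd g x : g \in digraph_aut Gamma ->
    nbhd Gamma (g x) = g @: nbhd Gamma x.
  by move/digraph_autP; apply: nbhd_aut.
pose S := [set w | nbhd Gamma w == nbhd Gamma u].
case: (@primitive_block _ (digraph_aut_group Gamma) S primG).
- by apply/set0Pn; exists u; rewrite inE.
- move=> g Gg /pred0Pn[z /= /andP[Sgx /imsetP[x Sx def_gx]]].
  move: Sgx Sx; rewrite def_gx !inE => /eqP Sgx /eqP Sx.
  apply/setP=> y.
  rewrite -[y](permKV g) (mem_imset _ _ perm_inj) !inE -{2}Sgx -Sx.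
  by rewrite !(aut_nbhd g) // (inj_eq (imset_inj (@perm_inj _ g))).
- case/eqP/cards1P=> w defS.
  have: u \in S by rewrite inE.
  have: v \in S by rewrite inE euv.
  by rewrite defS !inE => /eqP-> /eqP->.
move=> ST.
have nbhdE w : nbhd Gamma w = nbhd Gamma u.
  by apply/eqP; have: w \in S by [rewrite ST inE]; rewrite inE.
have [N0 | [y Ny]] := set_0Vmem (nbhd Gamma u).
  by case: nG0; apply/setP=> -[x z]; have/setP/(_ z) := nbhdE x; rewrite N0 !inE.
case: nGT; apply/setP=> -[x z]; rewrite [RHS]inE.
have [g Gg def_z] := atransP2 trG (in_setT y) (in_setT z).
have: g y \in g @: nbhd Gamma u by apply: imset_f.
by rewrite -aut_nbhd // nbhdE -(nbhdE x) inE def_z.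
Qed.

Local Open Scope ring_scope.

Theorem theorem1p1 (Omega : finType) (Gamma : {set Omega * Omega})
    (n d : nat) (kappa : int) :
  vertex_primitive Gamma ->
  Gamma <> set0 ->
  Gamma <> [set: Omega * Omega] ->
  n = #|Omega| ->
  regular Gamma d ->
  least_positive (fun i : int => meet_graph Gamma d i <> set0) kappa ->
     (meet_graph Gamma d 0 :|: meet_graph Gamma d kappa = [set: Omega * Omega]
      /\ (n%:Z - 1) * (d%:Z - kappa) = d%:Z * (d%:Z - 1))
  \/ (exists i : int,
        kappa <= i <= d%:Z - 1 /\
        exists v : nat, regular (meet_graph Gamma d i) v /\
          (1 <= v%:Z <= kappa ^+ 2 + kappa)).
Proof.
move=> primG nG0 nGT def_n regG [].
case: kappa => // k k_gt0 nGk k_min.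
have {}k_gt0 : (0 < k)%N by lia.
have [trG _] := andP primG.
pose f u v := #|nbhd Gamma u :&: nbhd Gamma v|.
have meetE (i : nat) u v :
    ((u, v) \in meet_graph Gamma d i) = (f u v + i == d)%N.
  by rewrite inE /= -/(f u v); lia.
have fC u v : f u v = f v u by rewrite /f setIC.
have ff u : f u u = d by rewrite /f setIid regG.
have fD u v : (f u v + #|nbhd Gamma u :\: nbhd Gamma v| = d)%N.
  by rewrite cardsID regG.
have f_lt u v : u != v -> (f u v < d)%N.
  move=> neq_uv; rewrite ltn_neqAle -{2}(fD u v) leq_addr andbT.
  apply: contraNneq neq_uv => fd; apply/eqP/(nbhd_inj primG nG0 nGT)/eqP.
  rewrite eqEcard !regG leqnn andbT; apply/setIidPl/eqP.
  by rewrite eqEcard subsetIl regG -/(f u v) fd leqnn.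
(* The index [d - f u v] is positive and its graph contains [(u, v)], so it is at least [k]. *)
have f_le u v : u != v -> (f u v + k <= d)%N.
  move=> /f_lt fd; have := k_min (d - f u v)%N.
  have ne : meet_graph Gamma d (d - f u v)%N <> set0.
    by apply/eqP/set0Pn; exists (u, v); rewrite meetE; lia.
  by move=> /(_ _ ne); lia.
have f_ge u v : (d + d <= f u v + n)%N.
  rewrite -{1}(regG u) -(regG v) -cardsUI -/(f u v) addnC leq_add2l def_n.
  exact: max_card.
have n_gt0 : (0 < n)%N.
  rewrite def_n; have [x _ _] := imsetP trG; by apply/card_gt0P; exists x.
have k_le_d : (k <= d)%N.
  by case/eqP/set0Pn: nGk => -[u v]; rewrite meetE; lia.
have [d' regC] : exists d', regular (converse Gamma) d'.
  apply: (@transitive_regular _ (digraph_aut_group Gamma)) => // g x y.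
  by move/digraph_autP=> gG; rewrite !inE gG.
have {d'} regC : regular (converse Gamma) d.
  suff <- : d' = d by [].
  have := sum_card_nbhd_converse Gamma.
  under eq_bigr => x _ do rewrite regC.
  under [RHS]eq_bigr => x _ do rewrite regG.
  by rewrite !sum_nat_const -def_n => /eqP; rewrite eqn_pmul2l // => /eqP.
have case1 : (forall u v, u != v -> (f u v + k)%N = d) ->
    meet_graph Gamma d 0 :|: meet_graph Gamma d k = [set: Omega * Omega] /\
    (n%:Z - 1) * (d%:Z - k%:Z) = d%:Z * (d%:Z - 1).
  move=> f_eq; split.
    apply/setP=> -[u v]; rewrite in_setU !meetE [RHS]inE.
    by have [-> | /f_eq->] := eqVneq u v; rewrite ?ff ?addn0 eqxx ?orbT.
  have sumf u : (\sum_v f u v = d + n.-1 * (d - k))%N.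
    rewrite (bigD1 u) //= ff; congr addn.
    under eq_bigr => v nvu.
      have -> : f u v = (d - k)%N by rewrite -(f_eq u v) ?addnK // eq_sym.
      over.
    by rewrite sum_nat_const cardC1 def_n.
  (* Two counts of the pairs of arcs with a common head; cancelling [n] and then [d] leaves the
     identity of (1). *)
  have: (n * (d + n.-1 * (d - k)) = n * d ^ 2)%N.
    have := sum_card_nbhdI Gamma.
    under eq_bigr => u _ do rewrite [\sum_v _]sumf.
    under [RHS]eq_bigr => u _ do rewrite regC.
    by rewrite !sum_nat_const -def_n.
  move/eqP; rewrite eqn_pmul2l // -mulnn => /eqP.
  have -> : n%:Z - 1 = n.-1%:Z by lia.
  have -> : d%:Z - k%:Z = (d - k)%N%:Z by lia.
  by move: (d - k)%N n.-1 => a b; lia.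
(* In both extreme cases the bound [f_le] is attained: it meets [f u v >= 0] when [d <= k], and
   [f_ge] when [n <= d + k]. *)
case: (ltnP k d) => [kd | dk]; last first.
  by left; apply: case1 => u v /f_le; lia.
case: (ltnP (d + k) n) => [dkn | ndk]; last first.
  by left; apply: case1 => u v /f_le; have := f_ge u v; lia.
right; exists k; split; first by lia.
have autE g x y : g \in digraph_aut Gamma ->
    ((g x, g y) \in meet_graph Gamma d k) = ((x, y) \in meet_graph Gamma d k).
  move/digraph_autP=> gG; rewrite !meetE /f !(nbhd_aut _ gG) -imsetI.
    by rewrite card_imset //; apply: perm_inj.
  by move=> a b _ _; apply: perm_inj.
have [m regE] := @transitive_regular _ (digraph_aut_group Gamma) _ trG autE.
exists m; split=> //; have cardE := card_regular regE.
have m_gt0 : (0 < m)%N.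
  rewrite lt0n; apply/eqP=> m0; case: nGk; apply: cards0_eq.
  by rewrite cardE m0 muln0.
have [| m_gt] := leqP m (k ^ 2 + k); first by lia.
have cut_gt z :
    (m * k < out_cut (meet_graph Gamma d k) (nbhd (converse Gamma) z))%N.
  apply: (primitive_out_cut_gt (G := digraph_aut_group Gamma)) => //.
  - by move=> x y; rewrite !meetE fC.
  - by move=> x; rewrite meetE ff; lia.
  - by rewrite regC.
  - by have := cardsC (nbhd (converse Gamma) z); rewrite regC -def_n; lia.
have sum_cut := sum_out_cut_nbhd_converse Gamma (meet_graph Gamma d k).
(* Each of the [n * m] arcs of the graph contributes [d - f u v = k], so the cuts average exactly
   [m * k], against [cut_gt]. *)
have: (\sum_z out_cut (meet_graph Gamma d k) (nbhd (converse Gamma) z)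
    = n * (m * k))%N.
  rewrite sum_cut mulnA def_n -cardE -sum_nat_const; apply: eq_bigr.
  by case=> u v; rewrite meetE /=; have := fD u v; lia.
have: (\sum_(z : Omega) (m * k).+1 <=
    \sum_z out_cut (meet_graph Gamma d k) (nbhd (converse Gamma) z))%N.
  by apply: leq_sum => z _; apply: cut_gt.
by rewrite sum_nat_const -def_n; lia.
Qed.
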